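(* Let $b_1,\dots,b_n$ be positive integers and $N=b_1+\dots+b_n$. Then the initial complex is the disjoint union of intervals $$\Delta_\prec=\bigsqcup_{u\in\mathcal S}[\mathcal G_u,\mathcal F_u],$$ where $[\mathcal G,\mathcal F]=\{H\in\Delta_\prec\mid \mathcal G\subseteq H\subseteq\mathcal F\}$. Consequently the Hilbert–Poincaré series of $R_{[\mathbf b]}$ is $$P_{R_{[\mathbf b]}}(t)=\frac{A_{[\mathbf b]}(t)}{(1-t)^{N+1}},\qquad A_{[\mathbf b]}(t)=\sum_{u\in\mathcal S}t^{\mathrm{desc}(u)}=\sum_kA([\mathbf b],k)t^k,$$ i.e. the $k$-th entry of the $h$-vector of $R_{[\mathbf b]}$ equals the Simon Newcomb number $A([\mathbf b],k)$.
   Context: Let $K$ be a field, $\mathcal M=\{0,\dots,b_1\}\times\dots\times\{0,\dots,b_n\}\subset\mathbb N^n$ with the componentwise partial order, $S=K[T_v\mid v\in\mathcal M]$ standard graded, $\mathcal J_{[\mathbf b]}=\ker(T_v\mapsto x_{1,v_1}\cdots x_{n,v_n})$, $R_{[\mathbf b]}=S/\mathcal J_{[\mathbf b]}$. $\prec$ is the reverse lexicographic order with respect to a linear extension of the componentwise order on the variables, and $\Delta_\prec$ is the simplicial complex on $\mathcal M$ whose Stanley–Reisner ideal is $\mathrm{in}_\prec(\mathcal J_{[\mathbf b]})$; its faces are the chains of $\mathcal M$. Let $\mathcal S$ be the set of words $u=u_1u_2\cdots u_N$ over $\{1,\dots,n\}$ containing the letter $i$ exactly $b_i$ times. A descent of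 $u$ is an index $1\le m\le N-1$ with $u_m>u_{m+1}$; $\mathrm{desc}(u)$ is the number of descents, and the Simon Newcomb number $A([\mathbf b],k)$ is the number of $u\in\mathcal S$ with exactly $k$ descents. With $\varepsilon_1,\dots,\varepsilon_n$ the standard basis of $\mathbb Z^n$, put $p_m(u)=\sum_{i=1}^m\varepsilon_{u_i}$ for $0\le m\le N$, $\mathcal F_u=\{p_0(u),\dots,p_N(u)\}$ (a maximal chain of $\mathcal M$; $u\mapsto\mathcal F_u$ is a bijection from $\mathcal S$ to the facets of $\Delta_\prec$) and $\mathcal G_u=\{p_m(u)\mid 1\le m\le N-1,\ u_m>u_{m+1}\}$ (the descent set). *)

(* Defs.v *)
From HB Require Import structures.
From mathcomp Require Import all_boot all_order all_algebra.
Set Implicit Arguments. Unset Strict Implicit. Unset Printing Implicit Defensive.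
Import GRing.Theory.

(* Letters 1..n of the paper are encoded as i : 'I_n (letter i+1). *)

Definition Ntot (n : nat) (b : 'I_n -> nat) : nat := \sum_(i < n) b i.

(* Ambient finite type of lattice points v : 'I_n -> {0..N}; M is the box. *)
Definition pt (n : nat) (b : 'I_n -> nat) := {ffun 'I_n -> 'I_(Ntot b).+1}.

Definition inM n (b : 'I_n -> nat) (v : pt b) : bool := [forall i, (v i <= b i)%N].

Definition leM n (b : 'I_n -> nat) (v w : pt b) : bool := [forall i, (v i <= w i)%N].

(* faces of Delta_prec: chains of M *)
Definition face n (b : 'I_n -> nat) (H : {set pt b}) : bool :=
  [forall v in H, inM v] &&
  [forall v in H, forall w in H, leM v w || leM w v].

Definition inS n (b : 'I_n -> nat) (u : seq 'I_n) : bool :=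
  [forall i, count_mem i u == b i].

(* m (1 <= m <= size u - 1) is a descent: u_m > u_{m+1} (1-indexed) *)
Definition isdesc n (u : seq 'I_n) (m : nat) : bool :=
  [&& (0 < m)%N, (m < size u)%N &
      (nth 0 (map val u) m < nth 0 (map val u) m.-1)%N].

Definition desc n (u : seq 'I_n) : nat := count (isdesc u) (iota 0 (size u)).

Definition pm n (b : 'I_n -> nat) (u : seq 'I_n) (m : nat) : pt b :=
  [ffun i => @inord (Ntot b) (count_mem i (take m u))].

Definition Fu n (b : 'I_n -> nat) (u : seq 'I_n) : {set pt b} :=
  [set pm b u (val m) | m : 'I_(size u).+1].

Definition Gu n (b : 'I_n -> nat) (u : seq 'I_n) : {set pt b} :=
  [set pm b u (val m) | m : 'I_(size u).+1 & isdesc u m].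

(* Simon Newcomb number A([b],k); words in S have length N *)
Definition SN n (b : 'I_n -> nat) (k : nat) : nat :=
  #|[set u : (Ntot b).-tuple 'I_n | inS b u && (desc u == k)]|.

Definition Apoly n (b : 'I_n -> nat) : {poly int} :=
  \sum_(u : (Ntot b).-tuple 'I_n | inS b u) 'X^(desc u).

(* ---- The ring R_[b] = S / J_[b] = image of T_v |-> x_{1,v_1}...x_{n,v_n}. ---- *)
(* Variables x_{i,j}, i : 'I_n, j : 'I_(N+1) (those with j > b_i are unused,    *)
(* which does not change the image subring).  A monomial of degree d in the T_v *)
(* is a d-tuple of points of M; its image is the monomial whose exponent of     *)
(* x_{i,j} is #{k | v_k(i) = j} (<= d).  The homogeneous piece of K[x] of the   *)
(* relevant degree is modelled as K-valued functions on exponent vectors        *)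
(* (monomials form a basis), and R_d = image of S_d = span of images.           *)
Definition expo n (b : 'I_n -> nat) (d : nat) (s : d.-tuple (pt b))
  : {ffun ('I_n * 'I_(Ntot b).+1) -> 'I_d.+1} :=
  [ffun ij => @inord d (count (fun v : pt b => v ij.1 == ij.2) s)].

Definition monoimg (K : fieldType) n (b : 'I_n -> nat) (d : nat) (s : d.-tuple (pt b))
  : {ffun {ffun ('I_n * 'I_(Ntot b).+1) -> 'I_d.+1} -> K^o} :=
  [ffun e => if e == expo s then (1 : K) else 0]%R.

Definition Rdeg (K : fieldType) n (b : 'I_n -> nat) (d : nat) :=
  <<[seq monoimg K s | s in [pred s : d.-tuple (pt b) | all (@inM n b) s]]>>%VS.

Definition hilbR (K : fieldType) n (b : 'I_n -> nat) (d : nat) : nat :=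
  \dim (Rdeg K b d).

(* Main.v *)
Require Import Defs.
From HB Require Import structures.
From mathcomp Require Import all_boot all_order all_algebra.
From mathcomp Require Import zify.
Set Implicit Arguments. Unset Strict Implicit. Unset Printing Implicit Defensive.
Import GRing.Theory.

(* The word attached to a chain H is the only one that passes through H and is
   weakly increasing between consecutive elements of H (and the endpoints of M).

   The monomials in the image of S_d correspond to families of n sorted d-tuples,
   the i-th one with entries in {0..b_i}; hence the Hilbert function is
   d |-> prod_i C(d + b_i, d). The same product counts the multisets of pairs
   (time, letter), with times in {0..d} and the letter i occurring b_i times.
   Sorting such a multiset lexicographically gives a word u in S together with a
   weakly increasing sequence of times which is strictly increasing at the
   descents of u, and there are C(d + N - desc u, N) such sequences. Multiplying
   the generating function of these numbers by (1 - t)^(N+1) gives t^(desc u). *)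

(** * Counting and filtering in sequences *)

Lemma sum_count_mem (T : finType) (s : seq T) :
  \sum_(x : T) count_mem x s = size s.
Proof.
elim: s => [|y s IHs] /=; first by rewrite big1.
by rewrite big_split /= IHs (bigD1 y) //= eqxx big1 // => x /negPf; rewrite eq_sym => ->.
Qed.

(** Once [p] fails at the head of a sorted sequence it fails on the whole tail. This serves to show
    that the letter copies below a chain element form a prefix. *)
Lemma filter_downclosed (T : eqType) (r : rel T) (p : pred T) (s : seq T) :
    transitive r -> sorted r s ->
    {in s &, forall x y, r x y -> p y -> p x} ->
  filter p s = take (count p s) s.
Proof.
move=> r_tr; elim: s => //= x s IHs r_s p_down.
case px: (p x) => /=.
  rewrite IHs ?(path_sorted r_s) // => y z ys zs; apply: p_down; rewrite inE ?ys ?zs orbT //.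
have p'P : all (predC p) s.
  apply/allP => y ys; apply/negP => py; move/negP: px; apply.
  apply: (p_down x y); rewrite ?mem_head ?inE ?ys ?orbT //.
  by move/(order_path_min r_tr)/allP: r_s; apply.
have /eqP s0 : filter p s == [::] by rewrite -(negbK (_ == _)) -has_filter -all_predC.
by rewrite s0 -size_filter s0.
Qed.

Lemma nth_downclosed (T : eqType) (p : pred T) (s : seq T) (x0 : T) l :
  filter p s = take (count p s) s -> l < size s -> p (nth x0 s l) = (l < count p s).
Proof.
move=> sE lt_l; case: ltnP => lk.
  rewrite -(nth_take x0 lk) -sE.
  by apply: (all_nthP _ (filter_all p s)); rewrite size_filter.
have : ~~ has p (drop (count p s) s).
  have := count_cat p (take (count p s) s) (drop (count p s) s).
  rewrite cat_take_drop -sE count_filter (eq_count (a2 := p)) => [|x /=]; last exact: andbb.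
  by rewrite -[LHS]addn0 => /addnI/esym/eqP; rewrite has_count lt0n negbK.
move/hasPn=> p'drop; apply/negbTE; rewrite -[l in nth _ _ l](subnKC lk) -nth_drop.
by apply/p'drop/mem_nth; rewrite size_drop ltn_sub2r // (leq_ltn_trans lk).
Qed.

(** * The decomposition of the complex into intervals *)

Section Words.
Variables (n : nat) (b : 'I_n -> nat).
Implicit Types (u : seq 'I_n) (H : {set pt b}).

Lemma size_inS u : inS b u -> size u = Ntot b.
Proof.
by move/forallP => uS; rewrite -sum_count_mem; apply: eq_bigr => i _; apply/eqP.
Qed.

Lemma pmE u m i : inS b u -> pm b u m i = count_mem i (take m u) :> nat.
Proof.
move=> uS; rewrite ffunE inordK // ltnS -(size_inS uS).
by rewrite (leq_trans (count_size _ _)) // size_take_min geq_minr.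
Qed.

Lemma count_take_le (T : Type) (a : pred T) (s : seq T) m1 m2 :
  m1 <= m2 -> count a (take m1 s) <= count a (take m2 s).
Proof.
move=> le12; rewrite -(cat_take_drop m1 (take m2 s)) count_cat take_takel //.
exact: leq_addr.
Qed.

Lemma leM_pm u m1 m2 : inS b u -> m1 <= m2 -> leM (pm b u m1) (pm b u m2).
Proof. by move=> uS le12; apply/forallP => i; rewrite !pmE // count_take_le. Qed.

Lemma mem_Fu u m : m <= size u -> pm b u m \in Fu b u.
Proof. by rewrite -ltnS => ltm; apply/imsetP; exists (Ordinal ltm). Qed.

Lemma mem_Gu u m : isdesc u m -> pm b u m \in Gu b u.
Proof.
move=> um; have ltm : m < (size u).+1 by case/and3P: um => _ /ltnW.
by apply/imsetP; exists (Ordinal ltm); rewrite ?inE.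
Qed.

Lemma face_Fu u : inS b u -> face (Fu b u).
Proof.
move=> uS; apply/andP; split.
  apply/forall_inP => _ /imsetP[m _ ->]; apply/forallP => i.
  rewrite pmE //; move/forallP/(_ i)/eqP: (uS) => <-.
  by rewrite -[X in _ <= count _ X](cat_take_drop m) count_cat leq_addr.
apply/forall_inP => _ /imsetP[m1 _ ->]; apply/forall_inP => _ /imsetP[m2 _ ->].
by apply/orP; case/orP: (leq_total m1 m2) => le12; [left | right]; apply: leM_pm.
Qed.

Lemma Gu_sub_Fu u : Gu b u \subset Fu b u.
Proof. by apply/subsetP => _ /imsetP[m _ ->]; rewrite mem_Fu // -ltnS ltn_ord. Qed.

Lemma nodesc_le u m q :
    m <= q < size u -> (forall k, m < k <= q -> ~~ isdesc u k) ->
  nth 0 (map val u) m <= nth 0 (map val u) q.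
Proof.
case/andP=> /subnKC <-; elim: (q - m) => [|k IHk] lt_u nodesc; first by rewrite addn0.
rewrite addnS in lt_u nodesc *.
apply: leq_trans (IHk _ _) _; first exact: ltnW.
  by move=> l /andP[ltml lel]; apply: nodesc; rewrite ltml (leq_trans lel).
have := nodesc (m + k).+1; rewrite ltnS leq_addr leqnn => /(_ isT).
by rewrite /isdesc lt_u /= -leqNgt.
Qed.

(* The first descent of u' after position m precedes the next occurrence of the
   letter a = u_m in u', so p_k(u') still has the a-coordinate of p_m, whereas
   every p_k(u) with k > m has a larger one. *)
Lemma first_difference u u' m (x0 : 'I_n) :
    inS b u -> inS b u' -> m < Ntot b -> take m u = take m u' ->
    nth x0 u m < nth x0 u' m -> Gu b u' \subset Fu b u ->
  False.
Proof.
move=> uS u'S ltm eqm; set a := nth x0 u m => lta /subsetP sGF.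
have szu := size_inS uS; have szu' := size_inS u'S.
have ua : 0 < count_mem a (drop m u).
  by rewrite (drop_nth x0) ?szu //= eqxx.
have u'a : a \in drop m u'.
  rewrite -has_pred1 has_count; move: ua.
  have := congr1 (count_mem a) eqm.
  move/forallP/(_ a)/eqP: (uS); move/forallP/(_ a)/eqP: (u'S).
  rewrite -{1}(cat_take_drop m u) -{1}(cat_take_drop m u') !count_cat => e1 e2 e3.
  by move: e2; rewrite e3 -e1 => /addnI ->.
set r := index a (drop m u'); have ltr : r < size (drop m u') by rewrite index_mem.
have ltq : m + r < size u' by rewrite size_drop in ltr; lia.
have u'q : nth x0 u' (m + r) = a by rewrite -nth_drop nth_index.
have [k /andP[ltmk lekq] dk] : exists2 k, m < k <= m + r & isdesc u' k.
  have /existsP[k /andP[]] : [exists k : 'I_(m + r).+1, (m < k <= m + r) && isdesc u' k].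
    rewrite -[[exists _, _]]negbK; apply/negP; rewrite negb_exists => /forallP nod.
    have nodesc k : m < k <= m + r -> ~~ isdesc u' k.
      by case/andP=> ltk lek; have := nod (Ordinal (lek : k < _.+1)); rewrite /= ltk lek.
    have := nodesc_le _ nodesc; rewrite leq_addr => /(_ ltq).
    rewrite !(nth_map x0) // ?szu' //= u'q; by rewrite leqNgt lta.
  by exists k.
have /imsetP[k' _ ekk'] := sGF _ (mem_Gu dk).
have cnt i : count_mem i (take k u') = count_mem i (take k' u).
  by rewrite -(pmE k i u'S) -(pmE k' i uS) ekk'.
(* The coordinates of a path point add up to its position on the path, so equal points of two words
   sit at the same position. *)
have ek : k = k' :> nat.
  have := sum_count_mem (take k u'); rewrite (eq_bigr _ (fun i _ => cnt i)) sum_count_mem.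
  rewrite !size_takel //; first by rewrite ltnW // (leq_ltn_trans lekq).
  by rewrite -ltnS ltn_ord.
have := cnt a; rewrite -ek => {}cnt.
have := count_take_le (pred1 a) u ltmk; rewrite -cnt (take_nth x0) ?szu //.
rewrite -cats1 count_cat /= eqxx eqm.
(* The first [a] in [u'] after the common prefix has index [m + r], counted from 0, and
   [k <= m + r]; hence no [a] is read between [m] and [k]. *)
suff -> : count_mem a (take k u') = count_mem a (take m u') by rewrite addn0 addn1 ltnn.
rewrite -(subnKC (ltnW ltmk)) takeD count_cat.
suff /count_memPn -> : a \notin take (k - m) (drop m u') by rewrite addn0.
by apply/negP => /index_ltn; rewrite -/r; lia.
Qed.

(** Prefixes are compared by induction. At the first disagreement the word with the smaller letter
    takes the role of [u] in [first_difference]; the required inclusion of a descent set in the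
    other facet passes through [H]. *)
Lemma interval_inj H u u' :
    inS b u -> inS b u' -> Gu b u \subset H -> H \subset Fu b u ->
    Gu b u' \subset H -> H \subset Fu b u' ->
  u = u'.
Proof.
move=> uS u'S GuH HFu Gu'H HFu'.
have szu := size_inS uS; have szu' := size_inS u'S.
suff eqt m : m <= Ntot b -> take m u = take m u'.
  by have := eqt _ (leqnn _); rewrite -{1}szu -szu' !take_size.
elim: m => [|m IHm] ltm; first by rewrite !take0.
have {}IHm := IHm (ltnW ltm).
case: u => [|x0 u0] in uS szu GuH HFu IHm *; first by rewrite -szu in ltm.
set v := x0 :: u0 in uS szu GuH HFu IHm *.
rewrite !(take_nth x0) ?szu ?szu' // IHm; congr rcons.
apply/val_inj; case: (ltngtP (nth x0 v m) (nth x0 u' m)) => // lt; exfalso.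
  exact: (first_difference uS u'S ltm IHm lt (subset_trans Gu'H HFu)).
exact: (first_difference u'S uS ltm (esym IHm) lt (subset_trans GuH HFu')).
Qed.

(* Sort the letter copies (i, j), 0 <= j < b_i, by the number t(i, j) of elements
   of the chain whose i-th coordinate is at most j, breaking ties by the letter i.
   The copies lying below v in H then form an initial segment, and each descent
   of the resulting word is a jump of t, hence is reached at an element of H. *)
Lemma interval_exists H : face H ->
  exists2 u, inS b u & Gu b u \subset H /\ H \subset Fu b u.
Proof.
case/andP => /forall_inP HM /forall_inP Hch.
pose t (z : 'I_n * 'I_(Ntot b)) := #|[set v in H | v z.1 <= z.2]|.
pose r : rel ('I_n * 'I_(Ntot b)) :=
  fun z z' => (t z < t z') || (t z == t z') && (z.1 <= z'.1).
have r_tot : total r by move=> z z'; rewrite /r; lia.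
have r_tr : transitive r by move=> z z' z''; rewrite /r; lia.
pose Z := sort r (enum [pred z : 'I_n * 'I_(Ntot b) | z.2 < b z.1]).
have Zsort : sorted r Z by apply: sort_sorted.
have b_le i : b i <= Ntot b by rewrite /Ntot (bigD1 i) //= leq_addr.
have cntZ (c : 'I_n -> nat) i : c i <= b i ->
    count_mem i (map fst (filter (fun z : 'I_n * 'I_(Ntot b) => z.2 < c z.1) Z)) = c i.
  move=> le_c; rewrite count_map count_filter count_sort -sum1_count big_enum_cond /=.
  pose f (j : 'I_(c i)) := (i, widen_ord (leq_trans le_c (b_le i)) j).
  have f_inj : injective f by move=> j j' [] /val_inj.
  rewrite sum1dep_card -[RHS]card_ord -(card_imset _ f_inj); apply: eq_card => -[i' j].
  rewrite !inE /=; apply/and3P/imsetP => [[ltb /eqP-> ltc]|[j' _ [-> ->]]] /=.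
    by exists (Ordinal ltc) => //; congr (_, _); apply: val_inj.
  by rewrite eqxx ltn_ord (leq_trans (ltn_ord _) le_c).
pose u := map fst Z; have uS : inS b u.
  apply/forallP => i; apply/eqP; rewrite -[RHS](cntZ b) //; congr (count_mem i (map fst _)).
  apply/esym/all_filterP/allP => z; rewrite mem_sort mem_enum //.
have downH v z z' : v \in H -> r z z' -> z'.2 < v z'.1 -> z.2 < v z.1.
  move=> vH rzz' ltz'; rewrite ltnNge; apply/negP => lez.
  (* An element counted by [t z'] cannot lie above [v], so it lies below [v] and is counted by [t z]
     too; [v] itself is counted only by [t z]. *)
  suff : t z' < t z.
    by case/orP: rzz' => [/ltnW|/andP[/eqP-> _]]; rewrite ?ltnn // leqNgt => /negPf->.
  apply/proper_card/properP; split; last first.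
    by exists v; rewrite inE vH //= -ltnNge.
  apply/subsetP => w; rewrite !inE => /andP[wH lew]; rewrite wH /=.
  have /orP[/forallP/(_ z'.1)|/forallP/(_ z.1)] := forall_inP (Hch v vH) w wH => le_vw.
    by have := leq_trans ltz' (leq_trans le_vw lew); rewrite ltnn.
  exact: leq_trans le_vw lez.
pose k (v : pt b) := count (fun z : 'I_n * 'I_(Ntot b) => z.2 < v z.1) Z.
have takeZ (v : pt b) : v \in H ->
    filter (fun z : 'I_n * 'I_(Ntot b) => z.2 < v z.1) Z = take (k v) Z.
  by move=> vH; apply: (filter_downclosed r_tr) => // z z' _ _; apply: downH.
have pm_k v : v \in H -> pm b u (k v) = v.
  move=> vH; apply/ffunP => i; apply/val_inj; rewrite /= pmE //.
  by rewrite -map_take -takeZ // (cntZ (fun i => v i)) //; move/forallP/(_ i): (HM v vH).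
exists u => //; split; last first.
  apply/subsetP => v vH; rewrite -(pm_k v vH); apply: mem_Fu.
  by rewrite size_map count_size.
apply/subsetP => x /imsetP[[m m_le]]; rewrite inE => /and3P[/= m_gt0 ltm desc_m] {x}->.
rewrite size_map in ltm.
case eZ : Z => [|z0 Z'] in ltm; first by [].
rewrite -eZ in ltm; set z := nth z0 Z m.-1; set z' := nth z0 Z m.
have ltz : z'.1 < z.1.
  by move: desc_m; rewrite -map_comp !(nth_map z0) //; lia.
have rzz' : r z z' by move/(sortedP z0)/(_ m.-1): Zsort; rewrite prednK //; apply.
have ltt : t z < t z' by case/orP: rzz' => // /andP[_]; rewrite leqNgt ltz.
(* Ties are broken by increasing letters, so a descent forces [t] to jump. The element [v]
   responsible for the jump has [z] below it but not [z'], so its prefix ends exactly at [m]. *)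
have [v] : exists v, v \in [set v in H | v z'.1 <= z'.2] :\: [set v in H | v z.1 <= z.2].
  apply/set0Pn; rewrite setD_eq0; apply: contraL ltt => /subset_leq_card.
  by rewrite -leqNgt.
rewrite !inE => /andP[+ /andP[vH]]; rewrite vH /= -ltnNge => ltv lev.
suff -> : m = k v by rewrite pm_k.
have kP l : l < size Z -> ((nth z0 Z l).2 < v (nth z0 Z l).1) = (l < k v).
  exact: nth_downclosed (takeZ v vH).
apply/anti_leq/andP; split.
  by rewrite -[m]prednK // -kP ?ltv //; apply: leq_ltn_trans (leq_pred m) ltm.
by rewrite leqNgt -kP // -leqNgt.
Qed.
End Words.

(** * Truncated power series *)

Section Congruence.
Local Open Scope ring_scope.
Variable (R : comNzRingType).
Implicit Types p q r : {poly R}.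

(** Equality of [take_poly m] plays the role of congruence modulo X^m. *)
Lemma eq_take_polyP m p q :
  (forall i, (i < m)%N -> p`_i = q`_i) <-> take_poly m p = take_poly m q.
Proof.
split=> [eqpq | eqpq i lti].
  by apply/polyP => i; rewrite !coef_take_poly; case: ifP => // /eqpq.
by move/polyP/(_ i): eqpq; rewrite !coef_take_poly lti.
Qed.

Lemma eq_take_polyMl m r p q :
  take_poly m p = take_poly m q -> take_poly m (r * p) = take_poly m (r * q).
Proof.
move/eq_take_polyP => eqpq; apply/eq_take_polyP => i lti; rewrite !coefM.
apply: eq_bigr => j _; rewrite eqpq //; exact: leq_ltn_trans (leq_subr _ _) lti.
Qed.

(** Each factor 1 - X replaces the coefficients by their successive differences, and by Pascal's
    rule this lowers [k] by one. *)
Lemma take_poly_geometric m k :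
  take_poly m ((1 - 'X) ^+ k.+1 * \poly_(d < m) 'C(d + k, k)%:R) = take_poly m (1 : {poly R}).
Proof.
have step j (c : nat -> R) : take_poly m ((1 - 'X) ^+ j.+1 * \poly_(d < m) c d) =
    take_poly m ((1 - 'X) ^+ j * \poly_(d < m) (c d - (if d is d'.+1 then c d' else 0))).
  rewrite exprSr -mulrA; apply/eq_take_polyMl/eq_take_polyP => i lti.
  rewrite mulrBl mul1r coefB coefXM !coef_poly lti; case: i lti => [|i] //= lti.
  by rewrite (ltnW lti).
elim: k => [|k IHk]; rewrite step.
  rewrite expr0 mul1r; apply/eq_take_polyP => i lti.
  rewrite coef_poly lti coef1 !bin0; case: i {lti} => [|i]; by rewrite ?subr0 ?bin0 ?subrr.
rewrite -IHk; apply/eq_take_polyMl/eq_take_polyP => i lti; rewrite !coef_poly lti.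
case: i {lti} => [|i]; first by rewrite subr0 !binn.
by rewrite addnS binS natrD [(i + k.+1)%N]addnS -addSn addrAC subrr add0r.
Qed.

(** For d < k <= N the binomial coefficient vanishes, so the series is X^k times the one of
    [take_poly_geometric]. *)
Lemma take_poly_geometric_shift m N k : (k <= N)%N ->
  take_poly m ((1 - 'X) ^+ N.+1 * \poly_(d < m) 'C(d + N - k, N)%:R)
  = take_poly m ('X^k : {poly R}).
Proof.
move=> le_kN; rewrite -['X^k]mulr1 -(eq_take_polyMl 'X^k (take_poly_geometric m N)).
rewrite mulrCA; apply/eq_take_polyMl/eq_take_polyP => i lti.
rewrite coefXnM !coef_poly lti; case: ltnP => [ltik|leki].
  by rewrite bin_small //; lia.
by rewrite (leq_ltn_trans (leq_subr _ _) lti) addnBAC.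
Qed.

End Congruence.

(** * The Hilbert function as a number of monomials *)

Section DeltaSpan.
Local Open Scope ring_scope.
Variables (K : fieldType) (E : finType).

Definition delta_fun (e : E) : {ffun E -> K^o} := [ffun e' => if e' == e then 1 else 0].

Lemma free_delta_fun (s : seq E) : uniq s -> free (map delta_fun s).
Proof.
case sE: s => [|e0 s0]; first by rewrite nil_free.
rewrite -{s0}sE => s_uniq.
apply/(@freeP _ _ _ (in_tuple (map delta_fun s))) => k /ffunP eq0 i.
have lt_s (j : 'I_(size (map delta_fun s))) : (j < size s)%N.
  by rewrite -(size_map delta_fun) ltn_ord.
have := eq0 (nth e0 s i); rewrite sum_ffunE !ffunE (bigD1 i) //= big1 => [|j ne_ji].
  by rewrite ffunE (nth_map e0) // ffunE eqxx addr0 /GRing.scale /= mulr1.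
rewrite ffunE (nth_map e0) // ffunE nth_uniq //.
by rewrite eq_sym (inj_eq val_inj) (negPf ne_ji) scaler0.
Qed.

Lemma dim_span_delta (s : seq E) : \dim <<map delta_fun s>> = #|s|.
Proof.
(* [#|s|] ignores repetitions, and so does the span; freeness needs the duplicates removed. *)
have -> : <<map delta_fun s>>%VS = <<map delta_fun (undup s)>>%VS.
  apply: eq_span => v.
  by apply/mapP/mapP => -[e es ->]; exists e => //; move: es; rewrite mem_undup.
have /eqP -> := free_delta_fun (undup_uniq s).
by rewrite size_map -(card_uniqP (undup_uniq s)); apply: eq_card => e; rewrite mem_undup.
Qed.

End DeltaSpan.

(** Distinct monomials are linearly independent, so the dimension is the number of exponent vectors
    reached, over any field. *)
Lemma hilbR_card (K : fieldType) n (b : 'I_n -> nat) d :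
  hilbR K b d = #|[set expo s | s : d.-tuple (pt b) & all (@inM n b) s]|.
Proof.
rewrite /hilbR /Rdeg; set P := [pred s | _].
have -> : [seq monoimg K s | s in P] = map (@delta_fun K _) [seq expo s | s in P].
  by rewrite -map_comp; apply: eq_map => s; apply/ffunP => e; rewrite !ffunE.
rewrite dim_span_delta; apply: eq_card => e.
apply/imageP/imsetP => -[s sP ->]; exists s => //; by rewrite inE in sP *.
Qed.

Lemma card_setfam (aT rT : finType) (F : aT -> {set rT}) :
  #|[set f : {ffun aT -> rT} | [forall x, f x \in F x]]| = \prod_x #|F x|.
Proof.
have := @card_family aT (fun=> rT) (fun x => [in F x]).
rewrite foldrE big_map big_enum => <-; apply: eq_card => f.
by rewrite inE; apply/forallP/familyP => h x; have := h x; rewrite ?inE.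
Qed.

Lemma count_mem_eq_perm (T : eqType) (s1 s2 : seq T) :
  (forall x, count_mem x s1 = count_mem x s2) -> perm_eq s1 s2.
Proof. by move=> eqc; apply/allP => x _ /=; rewrite eqc. Qed.

(** The ambient range is common to all letters while the bound [k] varies with the letter, so the
    entries are transported to ['I_k.+1]. *)
Lemma card_bounded_sorted m n k : k <= n ->
  #|[set t : m.-tuple 'I_n.+1 | sorted leq (map val t) && all (fun x : 'I_n.+1 => x <= k) t]|
    = 'C(m + k, m).
Proof.
move=> lekn; rewrite -card_sorted_tuples.
pose w := widen_ord (lekn : k < n.+1).
have w_inj : injective w by move=> x y [] /val_inj.
have {}w_inj : injective (map_tuple w : m.-tuple _ -> _).
  by move=> t t' /(congr1 val) /(inj_map w_inj)/val_inj.
rewrite -(card_imset _ w_inj); apply: eq_card => t; rewrite !inE.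
apply/andP/imsetP => [[t_s /allP t_k]|[t']].
  exists (map_tuple (fun x : 'I_n.+1 => inord x) t).
    rewrite inE -map_comp (@eq_in_map _ _ _ val _).1 // => x /t_k le_x.
    by rewrite /= inordK.
  apply/val_inj; rewrite /= -map_comp -[LHS]map_id; apply/eq_in_map => x /t_k le_x.
  by apply/val_inj; rewrite /= inordK.
rewrite inE => t'_s ->; rewrite -map_comp (eq_map (_ : val \o w =1 val)) //; split => //.
by apply/allP => _ /mapP[x _ ->] /=; rewrite -ltnS.
Qed.

Lemma card_ffun_sum d n k : k <= n ->
  #|[set g : {ffun 'I_d.+1 -> 'I_n.+1} | \sum_x g x == k]| = 'C(d + k, d).
Proof.
move=> lekn; rewrite -card_ord_partitions.
pose w := widen_ord (lekn : k < n.+1).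
pose h (t : d.+1.-tuple 'I_k.+1) : {ffun 'I_d.+1 -> 'I_n.+1} := [ffun x => w (tnth t x)].
have h_inj : injective h.
  move=> t t' /ffunP eqh; apply: eq_from_tnth => x; have := eqh x.
  by rewrite !ffunE => -[] /val_inj.
rewrite -(card_imset _ h_inj); apply: eq_card => g; rewrite inE.
apply/idP/imsetP => [/eqP sum_g|[t]].
  exists [tuple inord (g x) | x < d.+1].
    rewrite inE big_tuple; apply/eqP; rewrite -[RHS]sum_g; apply: eq_bigr => x _.
    by rewrite tnth_mktuple inordK // ltnS -sum_g (bigD1 x) //= leq_addr.
  apply/ffunP => x; apply/val_inj; rewrite ffunE tnth_mktuple /= inordK //.
  by rewrite ltnS -sum_g (bigD1 x) //= leq_addr.
rewrite inE big_tuple => /eqP sum_t ->; rewrite -[X in _ == X]sum_t.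
by apply/eqP/eq_bigr => x _; rewrite ffunE.
Qed.

Section Expo.
Variables (n : nat) (b : 'I_n -> nat) (d : nat).
Local Notation N := (Ntot b).

Lemma leb_Ntot i : b i <= N.
Proof. by rewrite /Ntot (bigD1 i) //= leq_addr. Qed.

Lemma expoE (s : d.-tuple (pt b)) i j :
  expo s (i, j) = count_mem j [seq (v : pt b) i | v <- s] :> nat.
Proof.
rewrite ffunE inordK; first by rewrite count_map.
by rewrite ltnS -[X in _ <= X](size_tuple s) count_size.
Qed.

Lemma expo_eqP (s s' : d.-tuple (pt b)) :
  expo s = expo s' <->
  forall i, perm_eq [seq (v : pt b) i | v <- s] [seq (v : pt b) i | v <- s'].
Proof.
split=> [/ffunP eqs i|eqs].
  by apply: count_mem_eq_perm => j; rewrite -!expoE eqs.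
by apply/ffunP => -[i j]; apply/val_inj; rewrite /= !expoE; apply/permP.
Qed.

(** An exponent vector amounts to one multiset of coordinates for each i. These multisets are
    independent of each other because M is a full box: any choice of coordinates gives points of
    M. *)
Lemma card_expo :
  #|[set expo s | s : d.-tuple (pt b) & all (@inM n b) s]| = \prod_i 'C(d + b i, d).
Proof.
pose F i := [set t : d.-tuple 'I_N.+1 |
  sorted leq (map val t) && all (fun x : 'I_N.+1 => x <= b i) t].
rewrite (eq_bigr (fun i => #|F i|)) => [|i _]; last by rewrite card_bounded_sorted ?leb_Ntot.
rewrite -card_setfam.
pose toS (f : {ffun 'I_n -> d.-tuple 'I_N.+1}) : d.-tuple (pt b) :=
  [tuple [ffun i => tnth (f i) k] | k < d].
have toSE f i : [seq (v : pt b) i | v <- toS f] = f i.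
  rewrite -[RHS]map_tnth_enum /= -map_comp; apply: eq_map => k /=; by rewrite ffunE.
rewrite -[RHS](@card_in_imset _ _ (fun f => expo (toS f))); last first.
  move=> f f'; rewrite !inE => /forallP Ff /forallP Ff' /expo_eqP eqf.
  apply/ffunP => i; apply/val_inj/(inj_map val_inj).
  apply: (sorted_eq leq_trans anti_leq).
  - by have := Ff i; rewrite inE => /andP[].
  - by have := Ff' i; rewrite inE => /andP[].
  by have := eqf i; rewrite !toSE; apply: perm_map.
apply: eq_card => e; apply/imsetP/imsetP => -[].
  move=> s; rewrite inE => /allP sM ->.
  pose r : rel 'I_N.+1 := fun x y => x <= y.
  (* Sorting each coordinate separately changes the points of the tuple but not the exponents. *)
  exists [ffun i => sort_tuple r (map_tuple (fun v : pt b => v i) s)].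
    rewrite inE; apply/forallP => i; rewrite ffunE inE /=; apply/andP; split.
      by rewrite sorted_map; apply: sort_sorted => x y; apply: leq_total.
    by rewrite all_sort; apply/allP => _ /mapP[v /sM /forallP/(_ i) vi ->].
  by apply/expo_eqP => i; rewrite toSE ffunE perm_sym perm_sort.
move=> f; rewrite inE => /forallP Ff ->; exists (toS f) => //.
rewrite inE; apply/allP => _ /mapP[k _ ->]; apply/forallP => i; rewrite ffunE.
by have := Ff i; rewrite inE => /andP[_ /allP]; apply; apply: mem_tnth.
Qed.

End Expo.

Lemma sum_count_mem_snd (S T : finType) (z : seq (S * T)) y :
  \sum_(x : S) count_mem (x, y) z = count_mem y (unzip2 z).
Proof.
elim: z => [|[x0 y0] z IHz] /=; first by rewrite big1.
rewrite big_split /= IHz; congr (_ + _).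
rewrite (bigD1 x0) //= big1 => [|x /negPf ne_x]; rewrite !xpair_eqE ?eqxx ?addn0 //.
by rewrite eq_sym ne_x.
Qed.

Lemma count_mem_flatten_nseq (T : finType) (f : T -> nat) y :
  count_mem y (flatten [seq nseq (f x) x | x <- enum T]) = f y.
Proof.
rewrite count_flatten sumnE !big_map -?enumT big_enum (bigD1 y) //= count_nseq /= eqxx mul1n.
by rewrite big1 ?addn0 // => x /negPf ne_x; rewrite count_nseq /= ne_x.
Qed.

(** Sums stand for the difference f - g, because subtraction in [nat] truncates. The uses are times
    against descents and entries against positions. *)
Lemma diff_mono (f g : nat -> nat) N :
    (forall m, m.+1 < N -> f m + g m.+1 <= f m.+1 + g m) ->
  forall m1 m2, m1 <= m2 < N -> f m1 + g m2 <= f m2 + g m1.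
Proof.
move=> fg m1 m2 /andP[/subnKC <-]; elim: (m2 - m1) => [|k IHk] ltN; first by rewrite addn0.
rewrite addnS in ltN *; have := fg _ ltN; have := IHk (ltnW ltN); lia.
Qed.

(** * Words with times *)

Section TimedWords.
Variables (d n : nat).

Definition lex_le : rel ('I_d.+1 * 'I_n) :=
  fun x y => (x.1 < y.1) || (x.1 == y.1) && (x.2 <= y.2).

Lemma lex_le_total : total lex_le.
Proof. by move=> [x1 x2] [y1 y2]; rewrite /lex_le -!val_eqE /=; lia. Qed.

Lemma lex_le_trans : transitive lex_le.
Proof. by move=> [x1 x2] [y1 y2] [z1 z2]; rewrite /lex_le -!val_eqE /=; lia. Qed.

Lemma lex_le_anti : antisymmetric lex_le.
Proof.
move=> [x1 x2] [y1 y2]; rewrite /lex_le -!val_eqE /= => h.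
by congr (_, _); apply/val_inj => /=; lia.
Qed.

(** These are the descents passed before reading the letter of index [m], counted from 0; position 0
    is never a descent. *)
Definition ndesc (u : seq 'I_n) m := count (isdesc u) (iota 0 m.+1).

Lemma ndescS u m : ndesc u m.+1 = ndesc u m + isdesc u m.+1.
Proof. by rewrite /ndesc -[in LHS]addn1 iotaD count_cat /= addn0. Qed.

Lemma ndesc_le u m : ndesc u m <= m.
Proof. by elim: m => // m IHm; rewrite ndescS; case: isdesc; lia. Qed.

Lemma desc_ndesc (u : seq 'I_n) : desc u = ndesc u (size u).-1.
Proof. by rewrite /ndesc /desc; case: u. Qed.

Lemma desc_le (u : seq 'I_n) : desc u <= size u.
Proof. by rewrite desc_ndesc (leq_trans (ndesc_le _ _)) ?leq_pred. Qed.

Lemma ndesc_mono u m1 m2 : m1 <= m2 -> ndesc u m1 <= ndesc u m2.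
Proof.
by move/subnKC <-; elim: (m2 - m1) => [|k]; rewrite ?addn0 // addnS ndescS; lia.
Qed.

(* The times increase weakly, and strictly at the descents of u. *)
Lemma sorted_timesP N (u : N.-tuple 'I_n) (t : N.-tuple 'I_d.+1) :
  reflect (forall m, m.+1 < N ->
             nth 0 (map val t) m + ndesc u m.+1 <= nth 0 (map val t) m.+1 + ndesc u m)
          (sorted lex_le (zip t u)).
Proof.
case: N u t => [|N] u t; first by rewrite [t]tuple0 [u]tuple0; constructor.
have szE : size t = size u by rewrite !size_tuple.
pose x0 := thead t; pose y0 := thead u.
apply: (iffP (sortedP (x0, y0))) => h m ltm.
  have := h m; rewrite size_zip !size_tuple minnn => /(_ ltm).
  rewrite !nth_zip // /lex_le /= ndescS /isdesc size_tuple ltm /=.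
  by rewrite !(nth_map x0) ?(nth_map y0) ?size_tuple -?val_eqE //=; lia.
rewrite size_zip !size_tuple minnn in ltm; have := h m ltm.
rewrite !nth_zip // /lex_le /= ndescS /isdesc size_tuple ltm /=.
by rewrite !(nth_map x0) ?(nth_map y0) ?size_tuple -?val_eqE //=; lia.
Qed.

Lemma nth_map_val N k (t : N.-tuple 'I_k) (i : 'I_N) : nth 0 (map val t) i = tnth t i.
Proof. by rewrite (nth_map (tnth t i)) ?size_tuple // -tnth_nth. Qed.

(* Adding m minus the number of descents up to m to the m-th entry turns the
   admissible sequences of times into the strictly increasing ones. *)
Lemma card_sorted_times N (u : N.-tuple 'I_n) :
  #|[set t : N.-tuple 'I_d.+1 | sorted lex_le (zip t u)]| = 'C(d + N - desc u, N).
Proof.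
have le_desc : desc u <= N by have := desc_le u; rewrite size_tuple.
have desc_N : desc u = ndesc u N.-1 by rewrite desc_ndesc size_tuple.
rewrite -card_ltn_sorted_tuples; set M := d + N - desc u.
pose S := [set s : N.-tuple 'I_M | sorted ltn (map val s)].
have SP (s : N.-tuple 'I_M) : s \in S -> forall m, m.+1 < N ->
    nth 0 (map val s) m + m.+1 <= nth 0 (map val s) m.+1 + m.
  rewrite inE => /(sortedP 0) s_lt m; have := s_lt m; rewrite size_map size_tuple => h /h /=; lia.
have S_lb (s : N.-tuple 'I_M) (i : 'I_N) : s \in S -> i <= tnth s i.
  move/SP/diff_mono/(_ 0 i); rewrite ltn_ord nth_map_val => /(_ isT).
  by rewrite addn0; apply: leq_trans (leq_addl _ _).
(* Room must remain below [M] for the N - 1 - i larger entries that follow. With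
   [M = d + N - desc u] this keeps the times of [g s] at most [d], so [inord] is harmless. *)
have S_ub (s : N.-tuple 'I_M) (i : 'I_N) : s \in S -> tnth s i + N.-1 < M + i.
  have ltN : N.-1 < N by rewrite prednK // (leq_ltn_trans _ (ltn_ord i)).
  move/SP/diff_mono/(_ i N.-1); rewrite ltN -ltnS prednK ?ltn_ord; last by lia.
  rewrite nth_map_val (nth_map_val s (Ordinal ltN)) => /(_ isT).
  have := ltn_ord (tnth s (Ordinal ltN)); lia.
pose g (s : N.-tuple 'I_M) : N.-tuple 'I_d.+1 := [tuple inord (tnth s i + ndesc u i - i) | i < N].
have gE (s : N.-tuple 'I_M) (i : 'I_N) : s \in S -> tnth (g s) i = tnth s i + ndesc u i - i :> nat.
  move=> sS; rewrite tnth_mktuple inordK //.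
  have : ndesc u i <= desc u by rewrite desc_N ndesc_mono //; have := ltn_ord i; lia.
  by have := S_ub s i sS; have := S_lb s i sS; have := ltn_ord i; rewrite /M; lia.
have g_inj : {in S &, injective g}.
  move=> s s' sS s'S eqg; apply: eq_from_tnth => i; apply/val_inj => /=.
  have := gE s i sS; rewrite eqg gE //; have := S_lb s i sS; have := S_lb s' i s'S; lia.
have g_sorted (s : N.-tuple 'I_M) : s \in S -> sorted lex_le (zip (g s) u).
  move=> sS; apply/sorted_timesP => m ltm; have := SP s sS m ltm.
  rewrite !(nth_map_val _ (Ordinal ltm)) !(nth_map_val _ (Ordinal (ltnW ltm))) !gE //=.
  have := S_lb s (Ordinal ltm) sS; have := S_lb s (Ordinal (ltnW ltm)) sS; rewrite /=; lia.
have g_surj (t : N.-tuple 'I_d.+1) : sorted lex_le (zip t u) -> exists2 s, s \in S & t = g s.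
  move/sorted_timesP => tP.
  (* Time minus descents is nondecreasing and ends at most at [d - desc u]; adding i <= N - 1 stays
     below [M]. *)
  have bound (i : 'I_N) : tnth t i + i - ndesc u i < M.
    have ltN : N.-1 < N by rewrite prednK // (leq_ltn_trans _ (ltn_ord i)).
    have leiN : i <= N.-1 by have := ltn_ord i; lia.
    have := diff_mono tP (m1 := i) (m2 := N.-1).
    rewrite ltN leiN nth_map_val (nth_map_val t (Ordinal ltN)) -desc_N => /(_ isT).
    have := ltn_ord (tnth t (Ordinal ltN)); have := ndesc_le u i; have := ltn_ord i.
    rewrite /M; lia.
  have sS : [tuple Ordinal (bound i) | i < N] \in S.
    rewrite inE; apply/(sortedP 0) => m; rewrite size_map size_tuple => ltm.
    rewrite (nth_map_val _ (Ordinal ltm)) (nth_map_val _ (Ordinal (ltnW ltm))) !tnth_mktuple /=.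
    have := tP m ltm; rewrite (nth_map_val _ (Ordinal ltm)) (nth_map_val _ (Ordinal (ltnW ltm))).
    have := ndesc_le u m; have := ndesc_le u m.+1; lia.
  exists [tuple Ordinal (bound i) | i < N] => //.
  apply: eq_from_tnth => i; apply/val_inj; rewrite /= gE // tnth_mktuple /=.
  have := ndesc_le u i; lia.
rewrite -/S -(card_in_imset g_inj); apply: eq_card => t; rewrite inE.
by apply/idP/imsetP => [/g_surj // | [s sS ->]]; apply: g_sorted.
Qed.

(** A timed word is the sorted listing of a multiset of pairs (time, letter), so it is determined by
    its multiplicities [c]. For the letter i these are d + 1 arbitrary naturals with sum [b i]. *)
Lemma card_timed_words (b : 'I_n -> nat) :
  #|[set p : (Ntot b).-tuple 'I_n * (Ntot b).-tuple 'I_d.+1 |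
      inS b p.1 && sorted lex_le (zip p.2 p.1)]| = \prod_i 'C(d + b i, d).
Proof.
set N := Ntot b.
pose F i := [set g : {ffun 'I_d.+1 -> 'I_N.+1} | \sum_x g x == b i].
rewrite (eq_bigr (fun i => #|F i|)) => [|i _]; last by rewrite card_ffun_sum ?leb_Ntot.
rewrite -card_setfam.
pose c (p : N.-tuple 'I_n * N.-tuple 'I_d.+1) : {ffun 'I_n -> {ffun 'I_d.+1 -> 'I_N.+1}} :=
  [ffun i => [ffun x => inord (count_mem (x, i) (zip p.2 p.1))]].
have cE p i x : c p i x = count_mem (x, i) (zip p.2 p.1) :> nat.
  rewrite !ffunE inordK // ltnS (leq_trans (count_size _ _)) // size_zip !size_tuple.
  by rewrite minnn.
rewrite -[LHS](@card_in_imset _ _ c) => [|[u t] [u' t']]; last first.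
  rewrite !inE /= => /andP[_ s_ut] /andP[_ s_ut'] eqc.
  have eqz : zip t u = zip t' u'.
    apply: (sorted_eq lex_le_trans lex_le_anti) => //; apply: count_mem_eq_perm => -[x i].
    by rewrite -(cE (u, t)) -(cE (u', t')) eqc.
  congr (_, _); apply/val_inj => /=.
    by have := congr1 unzip2 eqz; rewrite !unzip2_zip ?size_tuple.
  by have := congr1 unzip1 eqz; rewrite !unzip1_zip ?size_tuple.
apply: eq_card => f; apply/imsetP/idP => [[[u t]]|].
  rewrite !inE /= => /andP[uS _] ->; apply/forallP => i; rewrite inE.
  rewrite (eq_bigr _ (fun x _ => cE _ i x)) sum_count_mem_snd unzip2_zip ?size_tuple //.
  by move/forallP: uS.
rewrite inE => /forallP Ff.
(* The inverse map: list every pair as often as [f] prescribes, then sort. *)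
pose z := sort lex_le (flatten [seq nseq (f y.2 y.1) y | y <- enum {: 'I_d.+1 * 'I_n}]).
have cz y : count_mem y z = f y.2 y.1.
  by rewrite count_sort (count_mem_flatten_nseq (fun y => f y.2 y.1 : nat)).
have sum_f i : \sum_x f i x = b i by have := Ff i; rewrite inE => /eqP.
have sz : size z == N.
  rewrite -sum_count_mem (eq_bigr _ (fun y _ => cz y)).
  rewrite -(pair_big predT predT (fun x i => f i x : nat)) /=.
  by rewrite exchange_big /=; apply/eqP/eq_bigr => i _.
have sz1 : size (unzip1 z) == N by rewrite size_map.
have sz2 : size (unzip2 z) == N by rewrite size_map.
exists (Tuple sz2, Tuple sz1).
  rewrite inE /= zip_unzip sort_sorted ?andbT; last exact: lex_le_total.
  apply/forallP => i; rewrite -sum_count_mem_snd -sum_f.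
  by apply/eqP/eq_bigr => x _; rewrite cz.
by apply/ffunP => i; apply/ffunP => x; apply/val_inj; rewrite /= cE /= zip_unzip cz.
Qed.

End TimedWords.

(** * The Hilbert series and the Simon Newcomb numbers *)

(** Both sides count timed words: the product formula gives their total number, and the right side
    groups them by the underlying word. *)
Lemma hilbR_sum_desc (K : fieldType) n (b : 'I_n -> nat) d :
  hilbR K b d = \sum_(u : (Ntot b).-tuple 'I_n | inS b u) 'C(d + Ntot b - desc u, Ntot b).
Proof.
rewrite hilbR_card card_expo -card_timed_words -sum1dep_card.
rewrite (eq_bigr (fun u : (Ntot b).-tuple 'I_n =>
  \sum_(t : (Ntot b).-tuple 'I_d.+1 | sorted (@lex_le d n) (zip t u)) 1)); last first.
  by move=> u _; rewrite sum1dep_card card_sorted_times.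
by rewrite pair_big_dep.
Qed.

Lemma Apoly_sum_SN n (b : 'I_n -> nat) :
  Apoly b = (\sum_(k < (Ntot b).+1) ((SN b k)%:R : int) *: 'X^k)%R.
Proof.
have lt_desc (u : (Ntot b).-tuple 'I_n) : desc u < (Ntot b).+1.
  by rewrite ltnS -[X in _ <= X](size_tuple u) desc_le.
rewrite /Apoly (partition_big (fun u => Ordinal (lt_desc u)) predT) //=.
apply: eq_bigr => k _; rewrite (eq_bigr (fun=> 'X^k)%R) => [|u /andP[_ /eqP <-]] //.
rewrite big_const /SN iter_addr_0 scaler_nat; congr (_ *+ _)%R.
by apply: eq_card => u; rewrite !inE.
Qed.

Local Open Scope ring_scope.

Lemma hilbert_series (K : fieldType) n (b : 'I_n -> nat) m :
  take_poly m ((1 - 'X) ^+ (Ntot b).+1 * \sum_(d < m) ((hilbR K b d)%:R : int) *: 'X^d)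
    = take_poly m (Apoly b).
Proof.
have -> : \sum_(d < m) ((hilbR K b d)%:R : int) *: 'X^d =
    \sum_(u : (Ntot b).-tuple 'I_n | inS b u)
       \poly_(d < m) 'C(d + Ntot b - desc u, Ntot b)%:R.
  rewrite -(poly_def m (fun d => (hilbR K b d)%:R)); apply/polyP => i.
  rewrite coef_sum coef_poly; case: ltnP => lti.
    rewrite hilbR_sum_desc natr_sum; apply: eq_bigr => u _; by rewrite coef_poly lti.
  by rewrite big1 // => u _; rewrite coef_poly ltnNge lti.
rewrite mulr_sumr /Apoly !raddf_sum /=; apply: eq_bigr => u _.
by apply: take_poly_geometric_shift; rewrite -[X in (_ <= X)%N](size_tuple u) desc_le.
Qed.

Theorem mainTheorem10 (K : fieldType) (n : nat) (b : 'I_n -> nat)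
    (hb : forall i, (0 < b i)%N) :
  (* Delta_prec is the disjoint union of the intervals [G_u, F_u], u in S *)
  ((forall u : seq 'I_n, inS b u -> face (Fu b u) /\ Gu b u \subset Fu b u) /\
   (forall H : {set pt b}, face H ->
      exists! u : seq 'I_n, inS b u /\ Gu b u \subset H /\ H \subset Fu b u)) /\
  (* A_[b](t) = sum_k A([b],k) t^k *)
  Apoly b = \sum_(k < (Ntot b).+1) ((SN b k)%:R : int) *: 'X^k /\
  (* P_R(t) = A_[b](t) / (1-t)^(N+1), as an identity of formal power series
     (checked modulo t^(D+1) for every D) *)
  (forall D : nat,
     take_poly D.+1
       ((1 - 'X) ^+ (Ntot b).+1 *
          \sum_(d < D.+1) ((hilbR K b d)%:R : int) *: 'X^d)
     = take_poly D.+1 (Apoly b)).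
Proof.
split; last by split=> [|D]; [apply: Apoly_sum_SN | apply: hilbert_series].
split=> [u uS|H Hface]; first by split; [apply: face_Fu | apply: Gu_sub_Fu].
have [u uS [GuH HFu]] := interval_exists Hface.
exists u; split=> [//|u' [u'S [Gu'H HFu']]]; exact: interval_inj GuH HFu Gu'H HFu'.
Qed.
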